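(* For every real $x\ge1$ we have $$\#\{n\le x:\ \mathcal{H}(n,-2)\ne0\}\le3\log_2x.$$ Moreover, for each integer $d\ge3$ there is a real number $\delta_d$ with $\delta_d<1+\log_2(1-2^{-d})<1$ such that for every $\zeta\in\mathbb{C}$ with $\zeta^d=1$, $$\#\{n\le x:\ \mathcal{H}(n,2\zeta)\ne0\}=O(x^{\delta_d}).$$ Here $n$ ranges over positive integers.
   Context: For an integer $n\ge0$ with binary expansion $n=\sum_{j=0}^l\varepsilon_j2^j$, $\varepsilon_j\in\{0,1\}$, put $S(n,t)=\sum_{j=0}^l\varepsilon_jt^j$. For $n\ge1$ let $\mathcal{H}(n,t)=\det[S(i+j,t)]_{0\le i,j<n}$, a polynomial in $t$. *)

(* Defs.v *)
From mathcomp Require Import all_boot all_order all_algebra.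
From mathcomp Require Import all_classical all_reals all_analysis.
From mathcomp Require Import complex.

Set Implicit Arguments.
Unset Strict Implicit.
Unset Printing Implicit Defensive.

Import Order.TTheory GRing.Theory Num.Theory.
Local Open Scope ring_scope.

(* [odd (n %/ 2 ^ j)] is the j-th binary digit of n; for n > 0 the top digit
   has index [trunc_log 2 n], and [trunc_log 2 0 = 0] gives [digit_poly 0 = 0]. *)
Definition digit_poly (n : nat) : {poly int} :=
  \sum_(j < (trunc_log 2 n).+1) (odd (n %/ 2 ^ j))%:R *: 'X^j.

Definition hankel (n : nat) : {poly int} :=
  \det (\matrix_(i < n, j < n) digit_poly (i + j)).

(* Number of positive integers n <= x with P n; the bound on the index only
   makes the set finite, since n%:R <= x forces n <= Num.truncn x. *)
Definition count_upto (R : realType) (P : pred nat) (x : R) : nat :=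
  #|[set n : 'I_(Num.truncn x).+1 | [&& (0 < n)%N, n%:R <= x & P n]]|.

Definition log2 (R : realType) (x : R) : R := ln x / ln 2.

Import numFieldNormedType.Exports.

(* Makes [f =O_ +oo g] parse at infinity: the library only has this filter as a
   type-class instance, whereas its Landau notations use canonical structures. *)
Canonical pinfty_nbhs_filter_on (R : numFieldType) :=
  FilterType (pinfty_nbhs R) (@proper_pinfty_nbhs R).

(* Main.v *)
Require Import Defs.
From mathcomp Require Import all_boot all_order all_algebra perm.
From mathcomp Require Import all_classical all_reals all_analysis.
From mathcomp Require Import complex ring lra zify.

(** Let S be the evaluation of the digit polynomials at t, so that
    S(2n) = t S(n) and S(2n+1) = t S(n) + 1, and let D(n) = S(n+1) - S(n).  For
    a matrix M write s(M) for the slope of the affine function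
    x |-> det(M + xJ), where J is the all-ones matrix.  Put
      h = det [S(i+j)],  s = s [S(i+j)],  h' = det [D(i+j)],  s' = s [D(i+j)],
    all of size n, and w = 2/t.

    Sorting the indices of a Hankel matrix by parity and performing a few row
    and column operations makes it almost block diagonal, the blocks being
    again Hankel matrices of half the size plus multiples of J.  This expresses
    (h, s, h', s') at 2n and 2n+1 through the values at n and n+1
    ([hank_split], [hank_slope_split], [dhank_double], [dhank_doubleS] and
    companions).  Two consequences drive everything.  First,
    s' = w^k h' at an index of 2-adic valuation k ([dhank_slope_pow2_odd]);
    call an index regular if h' is nonzero there.  If w^d = 1, then
    h' - w s' = (1 - w^(k+1)) h' vanishes for k = d-1, and no positive multiple
    of 2^d is regular ([regular_dvd]).  Secondly, regularity of 2n forces that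
    of n, regularity of 2n+1 forces that of n and n+1, and h(n) <> 0 forces
    that of n/2 ([hank_regular]).

    Call n a twin if n and n+1 are regular.  Twins are closed under
    n |-> n/2, and by [regular_dvd] their binary expansions contain neither d
    consecutive zeros nor d consecutive ones.  An odd regular number 2n+1 comes
    from the twin n, and an even one is an odd one times a power of two below
    2^d; so it suffices to count twins.

    For t = -2 one has w^2 = 1, so the twins have alternating binary digits.
    There is one of each length, and following the recursions of h and s along
    this single branch leaves at most three indices for each of them
    ([hank_alt]).

    For t = 2 zeta with zeta^d = 1, give a twin whose last run of equal digits
    has length r the weight b^d - b^r.  If b^(d-1) (2 - b) <= 1, the two
    children 2n and 2n+1 of n weigh together at most b times as much as n
    ([run_weight_children]), so the number of twins below 2^L is O(b^L)
    ([count_bounded_runs]).  This condition holds with strict inequality at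
    b = 2 (1 - 2^-d), so it still holds for some smaller b
    ([run_base_exists]), and delta = log2 b. *)

Import Order.TTheory GRing.Theory Num.Theory numFieldNormedType.Exports.
Local Open Scope ring_scope.
Local Open Scope complex_scope.

(** * Determinants of matrices given by functions of two naturals *)

(** Entries are indexed by all naturals, so that cutting a matrix into blocks or
    permuting its indices needs no cast between ordinal types. *)
Definition ndet (R : comNzRingType) (n : nat) (F : nat -> nat -> R) : R :=
  \det (\matrix_(i < n, j < n) F i j).
Arguments ndet {R}.

Section NatIndexedDeterminants.
Context {R : comNzRingType}.
Implicit Types (n m : nat) (F G H : nat -> nat -> R) (a b c : nat -> R).

Lemma eq_ndet n F G :
  (forall i j, (i < n)%N -> (j < n)%N -> F i j = G i j) -> ndet n F = ndet n G.
Proof. by move=> eqFG; congr (\det _); apply/matrixP => i j; rewrite !mxE eqFG. Qed.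

Lemma ndet1 F : ndet 1 F = F 0%N 0%N.
Proof. by rewrite /ndet det_mx11 mxE. Qed.

Lemma ndet_tr n F : ndet n (fun i j => F j i) = ndet n F.
Proof. by rewrite /ndet -[RHS]det_tr; congr (\det _); apply/matrixP => i j; rewrite !mxE. Qed.

Lemma ndet_scale n a b F :
  ndet n (fun i j => a i * b j * F i j) =
  (\prod_(i < n) a i) * (\prod_(i < n) b i) * ndet n F.
Proof.
have -> : ndet n (fun i j => a i * b j * F i j) =
    \det (diag_mx (\row_(i < n) a i) *m (\matrix_(i < n, j < n) F i j) *m
          diag_mx (\row_(i < n) b i)).
  congr (\det _); apply/matrixP => i j.
  by rewrite mul_mx_diag mul_diag_mx !mxE mulrAC.
rewrite !det_mulmx !det_diag mulrAC; congr (_ * _ * _).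
  by apply: eq_bigr => i _; rewrite mxE.
by apply: eq_bigr => i _; rewrite mxE.
Qed.

Lemma ndet_scalec n (x : R) F : ndet n (fun i j => x * F i j) = x ^+ n * ndet n F.
Proof.
rewrite -[LHS](_ : ndet n (fun i j => x * 1 * F i j) = _).
  by rewrite (ndet_scale n (fun=> x) (fun=> 1)) big1_eq mulr1 prodr_const card_ord.
by apply: eq_ndet => i j _ _; rewrite mulr1.
Qed.

Lemma ndet_row_linear n i0 F G H :
  (i0 < n)%N -> (forall j, (j < n)%N -> F i0 j = G i0 j + H i0 j) ->
  (forall i j, i != i0 -> G i j = F i j) ->
  (forall i j, i != i0 -> H i j = F i j) ->
  ndet n F = ndet n G + ndet n H.
Proof.
move=> lt_i0n FGH GF HF.
rewrite -[ndet n G]mul1r -[ndet n H]mul1r.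
apply: (determinant_multilinear (i0 := Ordinal lt_i0n)).
- by apply/rowP => j; rewrite !mxE /= FGH // !mul1r.
- by apply/matrixP => i j; rewrite !mxE GF // eq_sym neq_bump.
- by apply/matrixP => i j; rewrite !mxE HF // eq_sym neq_bump.
Qed.

Lemma ndet_lblock m n F :
  (forall i j, (i < m)%N -> (m <= j < m + n)%N -> F i j = 0) ->
  ndet (m + n) F = ndet m F * ndet n (fun i j => F (m + i)%N (m + j)%N).
Proof.
move=> F0; rewrite /ndet -[X in \det X = _]submxK.
rewrite (_ : ursubmx _ = 0) ?det_lblock.
  by congr (_ * _); congr (\det _); apply/matrixP => i j; rewrite !mxE.
apply/matrixP => i j; rewrite !mxE /= F0 // leq_addr ltn_add2l; exact: ltn_ord.
Qed.

Lemma ndet_ublock m n F :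
  (forall i j, (m <= i < m + n)%N -> (j < m)%N -> F i j = 0) ->
  ndet (m + n) F = ndet m F * ndet n (fun i j => F (m + i)%N (m + j)%N).
Proof.
move=> F0; rewrite -ndet_tr ndet_lblock; last by move=> i j ? ?; exact: F0.
by congr (_ * _); exact: ndet_tr.
Qed.

Lemma ndet_reindex n p F :
  (forall i, (i < n)%N -> (p i < n)%N) ->
  (forall i j, (i < n)%N -> (j < n)%N -> p i = p j -> i = j) ->
  ndet n (fun i j => F (p i) (p j)) = ndet n F.
Proof.
move=> p_lt p_inj; pose q (i : 'I_n) := Ordinal (p_lt i (ltn_ord i)).
have q_inj : injective q by move=> i j [] /p_inj eq_ij; apply: val_inj; exact: eq_ij.
pose s := perm q_inj.
have -> : ndet n (fun i j => F (p i) (p j)) =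
    \det (row_perm s (col_perm s (\matrix_(i < n, j < n) F i j))).
  by congr (\det _); apply/matrixP => i j; rewrite !mxE !permE.
rewrite row_permE col_permE !det_mulmx !det_perm mulrC -mulrA odd_permV.
by rewrite -signr_addb addbb mulr1.
Qed.

Lemma ndet_unitrig n (L F : nat -> nat -> R) :
  (forall i, L i i = 1) ->
  (forall i j, (i < j)%N -> L i j = 0) \/ (forall i j, (j < i)%N -> L i j = 0) ->
  ndet n (fun i j => \sum_(k < n) L i k * F k j) = ndet n F.
Proof.
move=> L1 L0; pose M := \matrix_(i < n, j < n) L i j.
have detM : \det M = 1.
  case: L0 => L0; [|rewrite -det_tr]; rewrite det_trig.
  - by rewrite big1 // => i _; rewrite mxE.
  - by apply/is_trig_mxP => i j ?; rewrite mxE L0.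
  - by rewrite big1 // => i _; rewrite !mxE.
  - by apply/is_trig_mxP => i j ?; rewrite !mxE L0.
rewrite -[RHS]mul1r -detM -det_mulmx.
congr (\det _); apply/matrixP => i j; rewrite !mxE.
by apply: eq_bigr => k _; rewrite !mxE.
Qed.

Lemma ndet_row_op n c (g : nat -> nat) F :
  (forall i, (i < n)%N -> c i != 0 -> (g i < n)%N) ->
  (forall i, c i != 0 -> (g i < i)%N) \/ (forall i, c i != 0 -> (i < g i)%N) ->
  ndet n (fun i j => F i j + c i * F (g i) j) = ndet n F.
Proof.
move=> g_lt g_mono.
pose L i k : R := (i == k)%:R + c i * (g i == k)%:R.
have L0 i j : i != j -> (c i != 0 -> g i != j) -> L i j = 0.
  rewrite /L => /negPf->; rewrite add0r.
  by case: eqVneq => [->|_ /(_ isT)/negPf->]; rewrite ?mul0r ?mulr0.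
rewrite -[RHS](@ndet_unitrig n L).
- apply: eq_ndet => i j lt_in lt_jn.
  under eq_bigr do rewrite mulrDl.
  rewrite big_split /= (bigD1 (Ordinal lt_in)) //= eqxx mul1r big1 ?addr0.
    congr (_ + _).
    have [c0|cn0] := eqVneq (c i) 0.
      by rewrite c0 mul0r big1 // => k _; rewrite !mul0r.
    rewrite (bigD1 (Ordinal (g_lt _ lt_in cn0))) //= eqxx mulr1 big1 ?addr0 //.
    move=> k; rewrite -(inj_eq val_inj) /= eq_sym => /negPf->.
    by rewrite mulr0 mul0r.
  by move=> k; rewrite -(inj_eq val_inj) /= eq_sym => /negPf->; rewrite mul0r.
- move=> i; rewrite /L eqxx; case: (eqVneq (c i) 0) => [->|cn0].
    by rewrite mul0r addr0.
  rewrite (_ : (g i == i) = false) ?mulr0 ?addr0 //.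
  by case: g_mono => /(_ i cn0) lt; apply: negbTE; rewrite neq_ltn lt ?orbT.
- case: g_mono => g_mono; [left|right] => i j lt_ij; apply: L0.
  + by rewrite neq_ltn lt_ij.
  + by move=> /g_mono lt_gi; rewrite neq_ltn (ltn_trans lt_gi lt_ij).
  + by rewrite neq_ltn lt_ij orbT.
  + by move=> /g_mono lt_gi; rewrite neq_ltn (ltn_trans lt_ij lt_gi) orbT.
Qed.

(** The congruence by a unitriangular matrix: row operations followed by the
    same column operations, as suits symmetric matrices. *)
Lemma ndet_congr n c (g : nat -> nat) F :
  (forall i, (i < n)%N -> c i != 0 -> (g i < n)%N) ->
  (forall i, c i != 0 -> (g i < i)%N) \/ (forall i, c i != 0 -> (i < g i)%N) ->
  ndet n (fun i j => F i j + c i * F (g i) j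
                     + c j * (F i (g j) + c i * F (g i) (g j))) = ndet n F.
Proof.
move=> g_lt g_mono.
rewrite (ndet_tr n (fun j i => F i j + c i * F (g i) j
                     + c j * (F i (g j) + c i * F (g i) (g j)))).
rewrite (ndet_row_op n c g (fun j i => F i j + c i * F (g i) j)) //.
by rewrite (ndet_tr n (fun i j => F i j + c i * F (g i) j)) ndet_row_op.
Qed.

(** The bordered determinant with zero corner, first row -b and first column a;
    it is the pairing of a and b through the adjugate of F. *)
Definition border n F a b : R :=
  ndet n.+1 (fun i j => match i, j with
    | 0%N, 0%N => 0
    | 0%N, j'.+1 => - b j'
    | i'.+1, 0%N => a i'
    | i'.+1, j'.+1 => F i' j'
  end).

(** Adding a constant to all entries is a rank-one perturbation, so the
    determinant is an affine function of that constant ([ndet_addc]); this is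
    its slope, the sum of all cofactors. *)
Definition slope n F : R := ndet n (fun i j => F i j + 1) - ndet n F.

(** Border F with the row (1, -b) and the column (1, a).  Clearing the first
    column leaves F + a b, while splitting the first row as (1, 0) + (0, -b)
    gives the two terms on the right. *)
Lemma ndet_rank1_border n F a b :
  ndet n (fun i j => F i j + a i * b j) = ndet n F + border n F a b.
Proof.
pose B (x y : R) (z : nat -> R) i j := match i, j with
    | 0%N, 0%N => x
    | 0%N, j'.+1 => - z j'
    | i'.+1, 0%N => y * a i'
    | i'.+1, j'.+1 => F i' j'
  end.
transitivity (ndet n.+1 (B 1 1 b)).
  pose c i : R := if i is i'.+1 then - a i' else 0.
  rewrite -(ndet_row_op n.+1 c (fun=> 0%N)) //; last first.
    by left=> -[|i] //=; rewrite eqxx.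
  rewrite (ndet_ublock 1 n) ?ndet1 /= ?mul0r ?addr0 ?mul1r.
    by apply: eq_ndet => i j _ _; rewrite /= mulrNN.
  by case=> [|i] [|j] //= _ _; rewrite mulr1 mul1r subrr.
rewrite (ndet_row_linear n.+1 0 _ (B 1 1 (fun=> 0)) (B 0 1 b)) //.
- congr (_ + _); last by apply: eq_ndet => -[|i] [|j] //= _ _; rewrite mul1r.
  rewrite (ndet_lblock 1 n) ?ndet1 /= ?mul1r //.
  by case=> [|i] [|j] //= _ _; rewrite oppr0.
- by case=> [|j] _ /=; rewrite ?addr0 // oppr0 add0r.
- by case.
- by case.
Qed.

Lemma border_scale_r n F a b x :
  border n F a (fun j => x * b j) = x * border n F a b.
Proof.
pose z (i : nat) : R := if i is 0%N then x else 1.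
pose o (i : nat) : R := 1.
transitivity ((\prod_(i < n.+1) z i) * (\prod_(i < n.+1) o i) * border n F a b).
  rewrite /border -ndet_scale; apply: eq_ndet => -[|i] [|j] _ _ /=;
  by rewrite ?mulr0 ?mulr1 ?mul1r ?mulrN.
by rewrite [\prod_(i < _) o i]big1_eq big_ord_recl /= big1_eq !mulr1.
Qed.

Lemma border_add_r n F a b1 b2 :
  border n F a (fun j => b1 j + b2 j) = border n F a b1 + border n F a b2.
Proof.
apply: (ndet_row_linear n.+1 0) => //.
- by case=> [|j] _; rewrite ?addr0 ?opprD.
- by case.
- by case.
Qed.

Lemma border_tr n F a b :
  border n (fun i j => F j i) b a = border n F a b.
Proof.
pose z (i : nat) : R := if i is 0%N then -1 else 1.
transitivity ((\prod_(i < n.+1) z i) * (\prod_(i < n.+1) z i) * border n F a b).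
  rewrite /border -ndet_scale -ndet_tr.
  by apply: eq_ndet => -[|i] [|j] _ _ /=; rewrite ?mulr0 ?mulr1 ?mul1r ?mulrN ?mulN1r ?opprK.
by rewrite !big_ord_recl /= !big1_eq !mulr1 mulrNN !mul1r.
Qed.

Lemma border_add_l n F a1 a2 b :
  border n F (fun i => a1 i + a2 i) b = border n F a1 b + border n F a2 b.
Proof. by rewrite -(border_tr n F _ b) border_add_r !(border_tr n F _ b). Qed.

Lemma slope_border n F : slope n F = border n F (fun=> 1) (fun=> 1).
Proof.
rewrite /slope; have <- := addKr (ndet n F) (border n F (fun=> 1) (fun=> 1)).
rewrite -ndet_rank1_border addrC; congr (_ + _).
by apply: eq_ndet => i j _ _; rewrite mulr1.
Qed.

Lemma ndet_addc n F x :
  ndet n (fun i j => F i j + x) = ndet n F + x * slope n F.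
Proof.
rewrite slope_border -border_scale_r -ndet_rank1_border.
by apply: eq_ndet => i j _ _; rewrite mul1r mulr1.
Qed.

Lemma eq_slope n F G :
  (forall i j, (i < n)%N -> (j < n)%N -> F i j = G i j) -> slope n F = slope n G.
Proof.
move=> FG; rewrite /slope !(eq_ndet _ _ _ FG) (eq_ndet n _ (fun i j => G i j + 1)) //.
by move=> i j *; rewrite FG.
Qed.

Lemma slope_addc n F x : slope n (fun i j => F i j + x) = slope n F.
Proof.
rewrite /slope (eq_ndet _ (fun i j => _ + 1) (fun i j => F i j + (x + 1))).
  by rewrite !ndet_addc /slope; ring.
by move=> *; rewrite addrA.
Qed.

(** Subtracting 1 everywhere makes F block diagonal, and adding it back is the
    rank-one perturbation by (u + v)(u + v), with u and v the indicators of the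
    two blocks.  The bordered determinant is bilinear, its mixed terms vanish
    by triangularity, and the pure ones concern one block each. *)
Lemma ndet_offdiag1 m n F :
  (forall i j, (i < m)%N -> (m <= j < m + n)%N -> F i j = 1) ->
  (forall i j, (m <= i < m + n)%N -> (j < m)%N -> F i j = 1) ->
  ndet (m + n) F = ndet m F * ndet n (fun i j => F (m + i)%N (m + j)%N) -
                   slope m F * slope n (fun i j => F (m + i)%N (m + j)%N).
Proof.
move=> Fur Fdl.
pose u i : R := (i < m)%:R; pose v i : R := (m <= i)%:R.
pose G i j := F i j - 1; pose G0 i j : R := if (i < m)%N == (j < m)%N then G i j else 0.
have uv i : u i + v i = 1 by rewrite /u /v; case: ltnP; rewrite ?addr0 ?add0r.
pose K x y := border (m + n) G0 x y.
have detK x y : K x y = ndet (m + n) (fun i j => G0 i j + x i * y j) - ndet (m + n) G0.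
  by rewrite ndet_rank1_border addrC addKr.
pose P := ndet m F; pose Q := ndet n (fun i j => F (m + i)%N (m + j)%N).
pose P1 := ndet m G; pose Q1 := ndet n (fun i j => G (m + i)%N (m + j)%N).
have sP : slope m F = P - P1.
  rewrite /P1 /G (ndet_addc m F (-1)) /P; ring.
have sQ : slope n (fun i j => F (m + i)%N (m + j)%N) = Q - Q1.
  by rewrite /Q1 /G (ndet_addc n (fun i j => F (m + i)%N (m + j)%N) (-1)) /Q; ring.
have blk x y : (forall i j, (i < m <= j)%N -> x i * y j = 0) \/
               (forall i j, (j < m <= i)%N -> x i * y j = 0) ->
   ndet (m + n) (fun i j => G0 i j + x i * y j) =
   ndet m (fun i j => G i j + x i * y j) *
   ndet n (fun i j => G (m + i)%N (m + j)%N + x (m + i)%N * y (m + j)%N).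
  case=> xy0; [rewrite ndet_lblock | rewrite ndet_ublock].
  - congr (_ * _); apply: eq_ndet => i j lti ltj; rewrite /G0 ?lti ?ltj //.
    by rewrite !ltnNge !leq_addr.
  - move=> i j lti /andP[lej _]; rewrite xy0 ?lti // addr0 /G0 lti.
    by rewrite ltnNge lej.
  - congr (_ * _); apply: eq_ndet => i j lti ltj; rewrite /G0 ?lti ?ltj //.
    by rewrite !ltnNge !leq_addr.
  - move=> i j /andP[lej _] ltj; rewrite xy0 ?ltj // addr0 /G0 ltj.
    by rewrite ltnNge lej.
have um i : (i < m)%N -> u i = 1 by rewrite /u => ->.
have vm i : (i < m)%N -> v i = 0 by rewrite /v ltnNge => /negPf->.
have un i : u (m + i)%N = 0 by rewrite /u ltnNge leq_addr.
have vn i : v (m + i)%N = 1 by rewrite /v leq_addr.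
have addr00 N (H : nat -> nat -> R) : ndet N (fun i j => H i j + 0 * 0) = ndet N H.
  by apply: eq_ndet => *; rewrite mulr0 addr0.
have det0 : ndet (m + n) G0 = P1 * Q1.
  rewrite -(addr00 _ G0) (blk (fun=> 0) (fun=> 0)); last by left=> *; rewrite mulr0.
  by congr (_ * _); apply: addr00.
have -> : ndet (m + n) F = P1 * Q1 + K (fun i => u i + v i) (fun i => u i + v i).
  rewrite -det0 -ndet_rank1_border; apply: eq_ndet => i j ltiN ltjN.
  rewrite !uv /G0 /G mulr1; have [lti|lei] := ltnP i m; have [ltj|lej] := ltnP j m;
    rewrite /= ?subrK ?add0r //; [rewrite Fur ?lej|rewrite Fdl ?lei] => //.
have Kuu : K u u = P * Q1 - P1 * Q1.
  rewrite detK blk ?det0; last by left=> i j /andP[_ lej]; rewrite /u (ltnNge j) lej mulr0.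
  congr (_ * _ - _); last by apply: eq_ndet => i j _ _; rewrite !un mulr0 addr0.
  by apply: eq_ndet => i j ? ?; rewrite !um // mulr1 subrK.
have Kvv : K v v = P1 * Q - P1 * Q1.
  rewrite detK blk ?det0; last by left=> i j /andP[lti _]; rewrite vm // mul0r.
  congr (_ * _ - _); last by apply: eq_ndet => i j _ _; rewrite !vn mulr1 subrK.
  by apply: eq_ndet => i j ? ?; rewrite !vm // mulr0 addr0.
have Kuv : K u v = 0.
  rewrite detK blk ?det0; last by right=> i j /andP[ltj _]; rewrite vm // mulr0.
  apply/eqP; rewrite subr_eq0; apply/eqP; congr (_ * _);
  apply: eq_ndet => i j ? ?; by rewrite ?un ?(vm j) // ?mulr0 ?mul0r addr0.
have Kvu : K v u = 0.
  rewrite detK blk ?det0; last by left=> i j /andP[lti _]; rewrite vm // mul0r.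
  apply/eqP; rewrite subr_eq0; apply/eqP; congr (_ * _);
  apply: eq_ndet => i j ? ?; by rewrite ?un ?(vm i) // ?mulr0 ?mul0r addr0.
rewrite /K border_add_r !border_add_l -!/(K _ _) Kuu Kvv Kuv Kvu sP sQ -/P -/Q.
ring.
Qed.

(** When the index m is the only link between the indices below and above it,
    the row m splits into its two halves, each leaving a block triangular
    matrix; the corner is shared between them arbitrarily. *)
Lemma ndet_arrow m n F x y :
  (forall i j, (i < m < j)%N -> F i j = 0) ->
  (forall i j, (j < m < i)%N -> F i j = 0) ->
  F m m = x + y ->
  ndet (m + n.+1) F =
    ndet m.+1 (fun i j => if (i == m) && (j == m) then x else F i j)
      * ndet n (fun i j => F (m.+1 + i)%N (m.+1 + j)%N)
  + ndet m F * ndet n.+1 (fun i j => if (i == 0%N) && (j == 0%N) then y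
                                     else F (m + i)%N (m + j)%N).
Proof.
move=> Fur Fdl Fmm.
pose G i j := if i == m then (if j == m then x else if (j < m)%N then F i j else 0) else F i j.
pose H i j := if i == m then (if j == m then y else if (m < j)%N then F i j else 0) else F i j.
rewrite (ndet_row_linear _ m _ G H); first last.
- by move=> i j /negPf; rewrite /H => ->.
- by move=> i j /negPf; rewrite /G => ->.
- by move=> j _; rewrite /G /H eqxx; case: ltngtP => [||->]; rewrite ?addr0 ?add0r.
- by rewrite -[X in (X < _)%N]addn0 ltn_add2l.
congr (_ + _).
  rewrite addnS -addSn ndet_lblock.
    congr (_ * _); apply: eq_ndet => i j lti ltj.
      rewrite /G; case: eqP => //= ->; case: eqP => // /eqP nej.
      by rewrite ltn_neqAle nej -ltnS ltj.
    by rewrite /G addSn gtn_eqF // ltnS leq_addr.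
  move=> i j lti /andP[ltj _]; rewrite /G; case: eqP => [_|/eqP nei].
    by rewrite gtn_eqF // ltnNge ltnW.
  by rewrite Fur // ltj andbT ltn_neqAle nei.
rewrite ndet_ublock.
  congr (_ * _); apply: eq_ndet => i j lti ltj.
    by rewrite /H ltn_eqF.
  have eqm k : (m + k == m)%N = (k == 0%N) by rewrite -{2}[m]addn0 eqn_add2l.
  rewrite /H !eqm; case: eqP => //= ->; case: eqP => // /eqP nej.
  by rewrite addn0 -{1}[m]addn0 ltn_add2l lt0n nej.
move=> i j /andP[lei _] ltj; rewrite /H; case: eqP => [_|/eqP nei].
  by rewrite ltn_eqF // ltnNge ltnW.
by rewrite Fdl // ltj ltn_neqAle eq_sym nei.
Qed.

End NatIndexedDeterminants.

(** * Hankel determinants of a sequence and of its differences *)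

Definition evens_first m i := (if i < m then i.*2 else (i - m).*2.+1)%N.

Section HankelRecursions.
Context {F : fieldType} (t : F) (S : nat -> F).
Hypotheses (t_neq0 : t != 0) (two_neq0 : 2 != 0 :> F).
Hypotheses (S_double : forall n, S n.*2 = t * S n)
           (S_doubleS : forall n, S n.*2.+1 = t * S n + 1).

Let D m := S m.+1 - S m.
Let w := 2 / t.
Definition hank n := ndet n (fun i j => S (i + j)%N).
Definition hank_slope n := slope n (fun i j => S (i + j)%N).
Definition dhank n := ndet n (fun i j => D (i + j)%N).
Definition dhank_slope n := slope n (fun i j => D (i + j)%N).
(** By affinity, this is the determinant of the matrix D(i+j) - w. *)
Definition dhank_shift n := dhank n - w * dhank_slope n.

Lemma ndet_scale_addc n (G : nat -> nat -> F) (c x : F) : c != 0 ->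
  ndet n (fun i j => c * G i j + x) = c ^+ n * (ndet n G + x / c * slope n G).
Proof.
move=> c_neq0; rewrite -ndet_addc -ndet_scalec; apply: eq_ndet => i j _ _.
by rewrite mulrDr mulrCA mulfV // mulr1.
Qed.

Lemma slope_scale_addc n (G : nat -> nat -> F) (c x : F) : c != 0 ->
  slope n (fun i j => c * G i j + x) = c ^+ n / c * slope n G.
Proof.
move=> c_neq0; rewrite slope_addc /slope ndet_scale_addc // ndet_scalec /slope.
by field.
Qed.

Lemma D_double n : D n.*2 = 1.
Proof. by rewrite /D S_doubleS S_double addrC addKr. Qed.

Lemma D_doubleS n : D n.*2.+1 = t * D n - 1.
Proof. by rewrite /D -doubleS S_doubleS S_double; ring. Qed.

Lemma ndet_evens_first m n (G : nat -> nat -> F) : (m == n) || (m == n.+1) ->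
  ndet (m + n) (fun i j => G (evens_first m i) (evens_first m j)) = ndet (m + n) G.
Proof.
move=> mn; apply: ndet_reindex => i; rewrite /evens_first; first by case: (ltnP i m); lia.
by move=> j; case: (ltnP i m); case: (ltnP j m); lia.
Qed.

(** After sorting by parity, subtract from every odd row and column the
    preceding even one: the diagonal blocks become t S(i+j) + x and
    t D(i+j) - 2, and the off-diagonal ones S(2k+1) - S(2k) = 1. *)
Lemma ndet_S_split m n x : (0 < m)%N -> (m == n) || (m == n.+1) ->
  ndet (m + n) (fun i j => S (i + j)%N + x) =
  t ^+ (m + n) * ((hank m + x / t * hank_slope m) * dhank_shift n
                  - hank_slope m * dhank_slope n / t ^+ 2).
Proof.
move=> m_gt0 mn; rewrite -(ndet_evens_first m n) //.
pose c i : F := if (i < m)%N then 0 else -1.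
pose g i := (i - m)%N.
rewrite -(ndet_congr _ c g); first last.
- by left=> i; rewrite /c /g; case: ltnP; rewrite ?eqxx // => lemi _; lia.
- by move=> i lti _; rewrite /g; lia.
have cE k : c (m + k)%N = -1 by rewrite /c ltnNge leq_addr.
have eE k : evens_first m (m + k) = k.*2.+1.
  by rewrite /evens_first ltnNge leq_addr addKn.
have e'E k : (k < n)%N -> evens_first m (g (m + k)%N) = k.*2.
  by move=> ltkn; rewrite /evens_first /g addKn; have -> : (k < m)%N by lia.
rewrite ndet_offdiag1.
- rewrite (eq_ndet m _ (fun i j => t * S (i + j)%N + x)); last first.
    by move=> i j lti ltj; rewrite /c /evens_first lti ltj -doubleD S_double; ring.
  rewrite (eq_slope m _ (fun i j => t * S (i + j)%N + x)); last first.
    by move=> i j lti ltj; rewrite /c /evens_first lti ltj -doubleD S_double; ring.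
  have E i j : (i < n)%N -> (j < n)%N ->
     let e k := evens_first m (m + k) in let e' k := evens_first m (g (m + k)%N) in
     S (e i + e j)%N + x + c (m + i)%N * (S (e' i + e j)%N + x) +
     c (m + j)%N * (S (e i + e' j)%N + x + c (m + i)%N * (S (e' i + e' j)%N + x))
     = t * D (i + j)%N - 2.
    move=> lti ltj /=; rewrite !cE !eE !e'E //.
    rewrite !(addSn, addnS) -!doubleD -doubleS.
    by rewrite /D !(S_double, S_doubleS); ring.
  rewrite (eq_ndet n _ _ E) (eq_slope n _ _ E).
  rewrite !ndet_scale_addc // !slope_scale_addc // /dhank_shift /w /hank /hank_slope /dhank /dhank_slope exprD.
  by field.
- move=> i j lti /andP[lej ltj]; rewrite /evens_first /c /g lti (ltnNge j m) lej /=.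
  have -> : (j - m < m)%N by lia.
  by rewrite addnS -doubleD S_double S_doubleS; ring.
- move=> i j /andP[lei lti] ltj; rewrite /evens_first /c /g ltj (ltnNge i m) lei /=.
  have -> : (i - m < m)%N by lia.
  by rewrite addSn -doubleD S_double S_doubleS; ring.
Qed.

(** The matrix of D(i+j) + x, sorted by parity, after the odd rows and columns
    have received the preceding even ones and the even ones have then lost half
    of the following odd ones.  When there is one more even index than odd
    ones, the last even index n has no odd partner and remains linked to the
    odd block. *)
Definition diff_blocks m n x i j : F :=
  if (i < m)%N then
    if (j < m)%N then
      if (i == n) && (j == n) then 1 + x else - 2^-1 * (t * D (i + j)%N - 2)
    else if i == n then t * D (i + (j - m))%N + 2 * x else 0
  else if (j < m)%N then
    if j == n then t * D ((i - m) + j)%N + 2 * x else 0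
  else 2 * (t * D ((i - m) + (j - m))%N + 2 * x).

Lemma ndet_D_split m n x : (0 < m)%N -> (m == n) || (m == n.+1) ->
  ndet (m + n) (fun i j => D (i + j)%N + x) = ndet (m + n) (diff_blocks m n x).
Proof.
move=> m_gt0 mn; rewrite -(ndet_evens_first m n) //.
pose c i : F := if (i < m)%N then 0 else 1.
pose g i := (i - m)%N.
rewrite -(ndet_congr _ c g); first last.
- by left=> i; rewrite /c /g; case: ltnP; rewrite ?eqxx // => lemi _; lia.
- by move=> i lti _; rewrite /g; lia.
pose G i j := if (i < m)%N then
    if (j < m)%N then 1 + x else t * D (i + (j - m))%N + 2 * x
  else if (j < m)%N then t * D ((i - m) + j)%N + 2 * x
  else 2 * (t * D ((i - m) + (j - m))%N + 2 * x).
rewrite (eq_ndet _ _ G); last first.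
  move=> i j lti ltj; rewrite /evens_first /c /g /G.
  have [ltim|leim] := ltnP i m; have [ltjm|lejm] := ltnP j m.
  - by rewrite -doubleD D_double; ring.
  - have -> : (j - m < m)%N by lia.
    by rewrite addnS -doubleD D_double D_doubleS; ring.
  - have -> : (i - m < m)%N by lia.
    by rewrite addSn -doubleD D_double D_doubleS; ring.
  - have -> : (i - m < m)%N by lia.
    have -> : (j - m < m)%N by lia.
    by rewrite !(addnS, addSn) -doubleD -doubleS !D_double D_doubleS; ring.
pose c' i : F := if (i < n)%N then - 2^-1 else 0.
pose g' i := (m + i)%N.
rewrite -(ndet_congr _ c' g'); first last.
- by right=> i _; rewrite /g'; lia.
- by move=> i lti; rewrite /g' /c'; case: (ltnP i n); rewrite ?eqxx //; lia.
apply: eq_ndet => i j lti ltj; rewrite /c' /g' /G /diff_blocks.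
rewrite !(ltnNge (m + _)) !leq_addr /= !addKn.
have half_in k : (k < m)%N -> (k < n)%N = (k != n) by lia.
have half_out k : (m <= k)%N -> (k < n)%N = false by lia.
have [ltim|leim] := ltnP i m; have [ltjm|lejm] := ltnP j m.
- rewrite (half_in i) // (half_in j) //.
  case: (eqVneq i n) => [->|_]; case: (eqVneq j n) => [->|_] /=;
    rewrite ?(addnC n i); by field.
- rewrite (half_in i) // (half_out j) //.
  by case: (eqVneq i n) => [->|_] /=; field.
- rewrite (half_out i) // (half_in j) //.
  by case: (eqVneq j n) => [->|_] /=; field.
- rewrite (half_out i) // (half_out j) //; ring.
Qed.

Lemma ndet_D_double n x : (0 < n)%N ->
  ndet n.*2 (fun i j => D (i + j)%N + x) =
  (-1) ^+ n * t ^+ n.*2 * dhank_shift n * (dhank n + x * w * dhank_slope n).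
Proof.
move=> n_gt0; rewrite -addnn ndet_D_split ?eqxx // ndet_lblock; last first.
  by move=> i j lti /andP[lej _]; rewrite /diff_blocks lti ltnNge lej /= ltn_eqF.
rewrite (eq_ndet n _ (fun i j => - 2^-1 * (t * D (i + j)%N - 2))); last first.
  by move=> i j lti ltj; rewrite /diff_blocks lti ltj ltn_eqF.
rewrite (eq_ndet n (fun i j => diff_blocks _ _ _ (n + i)%N _)
          (fun i j => 2 * (t * D (i + j)%N + 2 * x))); last first.
  by move=> i j _ _; rewrite /diff_blocks !ltnNge !leq_addr /= !addKn.
rewrite !ndet_scalec !ndet_scale_addc // (exprNn 2^-1) exprVn exprD /dhank_shift /w.
by rewrite /dhank /dhank_slope; field; rewrite expf_neq0 // t_neq0.
Qed.

(** Here the matrix [diff_blocks] is an arrow centred at the unpaired even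
    index.  Its corner 1 + x is shared so that both sides become Hankel
    matrices of D again, the lower one with its row and column 0 halved, index 0
    standing for the unpaired n. *)
Lemma ndet_D_doubleS n x :
  ndet n.*2.+1 (fun i j => D (i + j)%N + x) =
  (-1) ^+ n.+1 / 2 * t ^+ n.*2.+1 *
    (dhank_shift n.+1 * (dhank n + x * w * dhank_slope n)
     - dhank_shift n * (dhank n.+1 + x * w * dhank_slope n.+1)).
Proof.
rewrite -addnn -addSn ndet_D_split ?eqxx ?orbT // addSnnS.
have out k : (n.+1 + k < n.+1)%N = false by rewrite ltnNge leq_addr.
rewrite (ndet_arrow n n _ (- 2^-1 * (t * D n.*2 - 2)) (2^-1 * (t * D n.*2 + 2 * x))).
- rewrite (eq_ndet n.+1 (fun i j => if (i == n) && _ then _ else _)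
              (fun i j => - 2^-1 * (t * D (i + j)%N - 2))); last first.
    move=> i j lti ltj; rewrite /diff_blocks lti ltj; case: eqP => //= ->.
    by case: eqP => //= ->; rewrite addnn.
  rewrite (eq_ndet n (fun i j => diff_blocks _ _ _ (n.+1 + i)%N _)
          (fun i j => 2 * (t * D (i + j)%N + 2 * x))); last first.
    by move=> i j _ _; rewrite /diff_blocks !out /= !addKn.
  rewrite (eq_ndet n (diff_blocks _ _ _) (fun i j => - 2^-1 * (t * D (i + j)%N - 2))); last first.
    by move=> i j lti ltj; rewrite /diff_blocks !ltnS (ltnW lti) (ltnW ltj) ltn_eqF.
  pose p i := if i is i'.+1 then i' else n.
  pose r i : F := if i is 0%N then 2^-1 else 1.
  rewrite (eq_ndet n.+1 (fun i j => if (i == 0%N) && _ then _ else _)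
     (fun i j => r i * r j * (2 * (t * D (p i + p j)%N + 2 * x)))); last first.
    move=> [|i] [|j] lti ltj /=.
    + by rewrite addnn; field.
    + by rewrite /diff_blocks addn0 ltnSn addnS -addSn out eqxx addKn; field.
    + by rewrite /diff_blocks addn0 ltnSn addnS -addSn out eqxx addKn; field.
    + by rewrite /diff_blocks !(addnS n) -!addSn !out !addKn !mul1r.
  rewrite ndet_scale (ndet_reindex _ p (fun i j => 2 * (t * D (i + j)%N + 2 * x))).
  + rewrite !big_ord_recl /= !big1_eq !mulr1.
    rewrite !ndet_scalec !ndet_scale_addc // !(exprNn 2^-1) !exprVn exprD !exprS /dhank_shift /w.
    by rewrite /dhank /dhank_slope; field; rewrite expf_neq0 // t_neq0 two_neq0.
  + by case=> [|i] /=; lia.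
  + by case=> [|i] [|j] /=; lia.
- move=> i j ltinj; rewrite /diff_blocks.
  have [-> ->] : (i < n.+1)%N = true /\ (j < n.+1)%N = false by lia.
  by rewrite ifN //; lia.
- move=> i j ltjni; rewrite /diff_blocks.
  have [-> ->] : (i < n.+1)%N = false /\ (j < n.+1)%N = true by lia.
  by rewrite ifN //; lia.
- by rewrite /diff_blocks ltnSn eqxx /=; field.
Qed.

Lemma hank_split m n : (0 < m)%N -> (m == n) || (m == n.+1) ->
  hank (m + n) = t ^+ (m + n) * (hank m * dhank_shift n - hank_slope m * dhank_slope n / t ^+ 2).
Proof.
move=> m_gt0 mn; rewrite {1}/hank (eq_ndet _ _ (fun i j => S (i + j)%N + 0)).
  by rewrite ndet_S_split // !mul0r addr0.
by move=> *; rewrite addr0.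
Qed.

Lemma hank_slope_split m n : (0 < m)%N -> (m == n) || (m == n.+1) ->
  hank_slope (m + n) = t ^+ (m + n) / t * hank_slope m * dhank_shift n.
Proof.
move=> m_gt0 mn; rewrite {1}/hank_slope /slope ndet_S_split // -/(hank _) hank_split //.
by field.
Qed.

Lemma dhank_affine n x :
  ndet n (fun i j => D (i + j)%N + x) = dhank n + x * dhank_slope n.
Proof. exact: ndet_addc. Qed.

Lemma dhank_double n : (0 < n)%N ->
  dhank n.*2 = (-1) ^+ n * t ^+ n.*2 * dhank_shift n * dhank n.
Proof.
move=> n_gt0; rewrite -[LHS]addr0 -[0](mul0r (dhank_slope n.*2)) -dhank_affine.
by rewrite ndet_D_double // !mul0r addr0.
Qed.

Lemma dhank_slope_double n : (0 < n)%N ->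
  dhank_slope n.*2 = (-1) ^+ n * t ^+ n.*2 * dhank_shift n * (w * dhank_slope n).
Proof.
move=> n_gt0; have := ndet_D_double n 1 n_gt0.
rewrite dhank_affine dhank_double // => /(canRL (addKr _)) E.
by rewrite -[LHS]mul1r E; ring.
Qed.

Lemma dhank_doubleS n :
  dhank n.*2.+1 = (-1) ^+ n.+1 * t ^+ n.*2 * (dhank_slope n * dhank n.+1 - dhank_slope n.+1 * dhank n).
Proof.
rewrite -[LHS]addr0 -[0](mul0r (dhank_slope n.*2.+1)) -dhank_affine.
rewrite ndet_D_doubleS !mul0r !addr0 /dhank_shift /w [t ^+ n.*2.+1]exprS; field; by rewrite t_neq0.
Qed.

(** At odd sizes slope and determinant agree, which starts the induction on the
    2-adic valuation in [dhank_slope_pow2_odd]. *)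
Lemma dhank_slope_doubleS n : dhank_slope n.*2.+1 = dhank n.*2.+1.
Proof.
have := ndet_D_doubleS n 1; rewrite dhank_affine => /(canRL (addKr _)) E.
rewrite -[LHS]mul1r E dhank_doubleS /dhank_shift /w [t ^+ n.*2.+1]exprS; field; by rewrite t_neq0.
Qed.

(** Doubling the size multiplies determinant and slope by a common factor,
    except for an additional w in the slope. *)
Lemma dhank_slope_pow2_odd k g (n := (2 ^ k * g.*2.+1)%N) : dhank_slope n = w ^+ k * dhank n.
Proof.
rewrite {}/n; elim: k => [|k IHk]; first by rewrite mul1n mul1r dhank_slope_doubleS.
rewrite expnS -mulnA mul2n.
have n_gt0 : (0 < 2 ^ k * g.*2.+1)%N by rewrite muln_gt0 expn_gt0.
by rewrite dhank_slope_double // dhank_double // IHk exprS; ring.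
Qed.

Lemma dhank_shift_pow2_odd k g (n := (2 ^ k * g.*2.+1)%N) :
  dhank_shift n = (1 - w ^+ k.+1) * dhank n.
Proof. by rewrite /dhank_shift /n dhank_slope_pow2_odd exprS; ring. Qed.

Lemma pow2_oddP n : (0 < n)%N -> exists k g, n = (2 ^ k * g.*2.+1)%N.
Proof.
move=> n_gt0; have [m + n_eq] := pfactor_coprime (isT : prime 2) n_gt0.
rewrite coprime2n => odd_m; exists (logn 2 n), m./2.
by rewrite {1}n_eq mulnC -[in LHS](odd_double_half m) odd_m.
Qed.

(** ** Indices with a nonzero difference determinant *)

(** By [dhank_slope_pow2_odd] the slope and the shifted determinant vanish at
    the other positive indices as well. *)
Definition regular n := dhank n != 0.

Lemma dhank_slope_regular n : (0 < n)%N -> dhank_slope n != 0 -> regular n.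
Proof.
by case/pow2_oddP => k [g ->]; rewrite dhank_slope_pow2_odd mulf_eq0 negb_or => /andP[].
Qed.

Lemma dhank_shift_regular n : (0 < n)%N -> dhank_shift n != 0 -> regular n.
Proof.
by case/pow2_oddP => k [g ->]; rewrite dhank_shift_pow2_odd mulf_eq0 negb_or => /andP[].
Qed.

Lemma regular_double n : (0 < n)%N -> regular n.*2 -> regular n.
Proof.
by move=> n_gt0; rewrite /regular dhank_double // mulf_eq0 negb_or => /andP[].
Qed.

(** The determinant at 2n+1 is a two-by-two determinant with rows
    (slope, determinant) at n and at n+1, and an irregular index makes its row
    zero. *)
Lemma regular_doubleS n : (0 < n)%N -> regular n.*2.+1 -> regular n && regular n.+1.
Proof.
move=> n_gt0; rewrite /regular dhank_doubleS mulf_eq0 negb_or => /andP[_].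
have S0 m : (0 < m)%N -> dhank m = 0 -> dhank_slope m = 0.
  move=> m_gt0 /eqP; apply: contraTeq => /dhank_slope_regular; exact.
apply: contraR; rewrite negb_and !negbK => /orP[] /eqP z; rewrite z.
  by rewrite (S0 n) // mul0r mulr0 subrr.
by rewrite (S0 n.+1) // mul0r mulr0 subrr.
Qed.

(** A regular 2n+1 makes n a twin.  Asking for n.+1 as well is what excludes long
    runs of ones, where the regularity of n only excludes long runs of zeros. *)
Definition twin n := regular n && regular n.+1.

Lemma twin_double n : (0 < n)%N -> twin n.*2 -> twin n.
Proof.
by move=> n_gt0 /andP[_ /(regular_doubleS _ n_gt0)].
Qed.

Lemma twin_doubleS n : (0 < n)%N -> twin n.*2.+1 -> twin n.
Proof.
by move=> n_gt0 /andP[/(regular_doubleS _ n_gt0)].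
Qed.

(** In the recursion of the Hankel determinant every term has a factor
    [dhank_shift] or [dhank_slope] at half the index. *)
Lemma hank_regular n : (1 < n)%N -> hank n != 0 -> regular n./2.
Proof.
move=> n_gt1; set m := n./2.
have m_gt0 : (0 < m)%N by rewrite half_gt0.
have dn : dhank_shift m != 0 -> regular m by apply: dhank_shift_regular.
have ds : dhank_slope m != 0 -> regular m by apply: dhank_slope_regular.
rewrite -(odd_double_half n) -/m -addnn addnA hank_split; last 2 first.
- by rewrite addn_gt0 m_gt0 orbT.
- by case: odd; rewrite eqxx ?orbT.
apply: contraNT => nreg.
have -> : dhank_shift m = 0 by apply/eqP; apply: contraNT nreg.
have -> : dhank_slope m = 0 by apply/eqP; apply: contraNT nreg.
by rewrite !(mulr0, mul0r) subrr mulr0.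
Qed.

Section RootOfUnity.
Variable d : nat.
Hypotheses (d_gt0 : (0 < d)%N) (wd1 : w ^+ d = 1).

(** Passing from 2^(d-1) g to 2^d g with g odd produces the factor 1 - w^d;
    higher powers of two inherit the vanishing. *)
Lemma regular_dvd m : (0 < m)%N -> ~~ regular (2 ^ d * m).
Proof.
case/pow2_oddP => j [g ->]; elim: j => [|j]; last first.
  apply: contra; rewrite expnS -!mulnA mulnCA mul2n; apply: regular_double.
  by rewrite !muln_gt0 !expn_gt0.
rewrite mul1n negbK -(prednK d_gt0) expnS -mulnA mul2n.
rewrite dhank_double ?muln_gt0 ?expn_gt0 // dhank_shift_pow2_odd prednK // wd1.
by rewrite subrr !(mul0r, mulr0).
Qed.

Lemma regular_pow2_odd k g : regular (2 ^ k * g.*2.+1) -> (k < d)%N.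
Proof.
apply: contraTltn => ledk; rewrite -(subnKC ledk) expnD -mulnA.
by apply: regular_dvd; rewrite muln_gt0 expn_gt0.
Qed.

End RootOfUnity.

(** ** Ratios of square one *)

Section SquareRootOfUnity.
Hypothesis w2 : w ^+ 2 = 1.

(** The number with k alternating binary digits 1, 0, 1, ...; it equals
    2^(k+1) / 3 rounded down. *)
Fixpoint alternating k := if k is k'.+1 then ((alternating k').*2 + ~~ odd (alternating k'))%N else 0%N.

Lemma regular_half_odd n : (0 < n)%N -> regular n.*2 -> odd n.
Proof.
move=> n_gt0; apply: contraTT => even_n.
rewrite -(even_halfK even_n) -!mul2n mulnA; apply: (regular_dvd 2) => //.
by rewrite half_gt0; case: n even_n n_gt0 => [|[]].
Qed.

(** Neither a twin nor its successor is divisible by 4, which determines its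
    last digit from the one before. *)
Lemma twin_alt n : (0 < n)%N -> twin n -> exists k, n = alternating k.
Proof.
elim/ltn_ind: n => n IHn n_gt0 tn.
have [n1|n_gt1] := leqP n 1; first by exists 1%N; case: n n_gt0 n1 {IHn tn} => [|[]].
have m_gt0 : (0 < n./2)%N by rewrite half_gt0.
have [k mk] : exists k, n./2 = alternating k.
  apply: IHn; rewrite ?ltn_half_double //; first by rewrite -addnn; lia.
  move: tn; rewrite -{1}(odd_double_half n); case: odd => /=.
    exact: twin_doubleS.
  exact: twin_double.
exists k.+1; rewrite /= -mk addnC -[LHS]odd_double_half; congr (nat_of_bool _ + _)%N.
move: tn; rewrite -{1}(odd_double_half n) /twin; case: (odd n) => /= /andP[r1 r2].
  by have := regular_half_odd n./2.+1 isT r2 => /= ->.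
by rewrite (regular_half_odd _ m_gt0 r1).
Qed.

Lemma regular_alt n : (0 < n)%N -> regular n -> exists k, n = alternating k \/ n = (alternating k).+1.
Proof.
have odd_case m : (0 < m)%N -> odd m -> regular m -> exists k, m = alternating k \/ m = (alternating k).+1.
  move=> m_gt0 om; have [m1 _|m_gt1] := leqP m 1.
    by exists 1%N; left; case: m m_gt0 m1 {om} => [|[]].
  rewrite -[m]odd_double_half om /= => /regular_doubleS; rewrite half_gt0 => /(_ m_gt1).
  move/twin_alt; rewrite half_gt0 => /(_ m_gt1)[k mk].
  by exists k.+1; rewrite mk /=; case: odd; [right|left]; lia.
case: (boolP (odd n)) => [|even_n n_gt0]; first by move=> ? ?; exact: odd_case.
have m_gt0 : (0 < n./2)%N by rewrite half_gt0; case: n even_n n_gt0 => [|[]].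
rewrite -(even_halfK even_n) => reg; have om := regular_half_odd _ m_gt0 reg.
have [k] := odd_case _ m_gt0 om (regular_double _ m_gt0 reg).
case=> mk; exists k.+1; move: om; rewrite mk /= => ->; [left|right]; lia.
Qed.

Lemma dhank_shift_odd n : (0 < n)%N -> dhank_shift n != 0 -> odd n.
Proof.
move=> n_gt0; apply: contraNT => even_n.
have [k [g n_eq]] := pow2_oddP n n_gt0; rewrite n_eq dhank_shift_pow2_odd.
case: k n_eq => [|[|k]] n_eq; first by rewrite n_eq mul1n /= odd_double in even_n.
  by rewrite w2 subrr mul0r.
rewrite mulf_eq0; apply/orP; right; apply: contraTT isT => reg.
by have := regular_pow2_odd 2 isT w2 k.+2 g reg.
Qed.

(** The slope at n is a multiple of the slope at the rounded-up half of n and of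
    [dhank_shift] at the rounded-down half, so only one index survives at each
    doubling. *)
Lemma hank_slope_alt n : (0 < n)%N -> hank_slope n != 0 -> exists k, n = (alternating k).+1.
Proof.
elim/ltn_ind: n => n IHn n_gt0.
have [n1|n_gt1] := leqP n 1; first by exists 0%N => /=; lia.
have m_gt0 : (0 < n./2)%N by rewrite half_gt0.
rewrite -{1}(odd_double_half n) -addnn addnA hank_slope_split; last 2 first.
- by rewrite addn_gt0 m_gt0 orbT.
- by case: odd; rewrite eqxx ?orbT.
rewrite !mulf_eq0 !negb_or => /andP[/andP[_ sm] fm].
have om := dhank_shift_odd _ m_gt0 fm.
have [||k mk] := IHn _ _ _ sm; [|by rewrite addn_gt0 m_gt0 orbT|].
  by move: (odd_double_half n); case: odd; lia.
exists k.+1; rewrite -[LHS]odd_double_half /=.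
move: mk om; case: (odd n) => /=; rewrite ?add1n ?add0n => mk.
  by case: mk => ->  ->; lia.
by rewrite mk /= => ->; lia.
Qed.

(** Each nonzero term in the recursion of the Hankel determinant needs a regular
    index n./2 which is odd or which comes with a nonzero slope; both are known
    up to one choice for each k. *)
Lemma hank_alt n : (1 < n)%N -> hank n != 0 ->
  exists k r, [/\ (0 < k)%N, (r < 3)%N & n = (alternating k.+1 + r)%N].
Proof.
move=> n_gt1 hn; have m_gt0 : (0 < n./2)%N by rewrite half_gt0.
have reg := hank_regular n n_gt1 hn.
(* The values 2 and 3 arise with k = 0; they are alternating 2 + 0 and + 1. *)
suff [k [r [r_lt3 n_eq]]] : exists k r, (r < 3)%N /\ n = (alternating k.+1 + r)%N.
  case: k n_eq => [|k] n_eq; last by exists k.+1, r.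
  by exists 1%N, r.-1; move: n_eq r_lt3 n_gt1 => /=; split; lia.
have [om|[k mk]] : odd n./2 \/ exists k, (odd n + n./2)%N = (alternating k).+1.
- have [fm0|fm] := eqVneq (dhank_shift n./2) 0; last by left; exact: dhank_shift_odd fm.
  right; apply: hank_slope_alt; first by rewrite addn_gt0 m_gt0 orbT.
  apply: contra_neq hn => s0; rewrite -(odd_double_half n) -addnn addnA hank_split.
  + by rewrite fm0 s0 !(mulr0, mul0r) subrr mulr0.
  + by rewrite addn_gt0 m_gt0 orbT.
  + by case: odd; rewrite eqxx ?orbT.
- have [k [] mk] := regular_alt _ m_gt0 reg; exists k; rewrite mk in om.
  + by exists (odd n); move: om (odd_double_half n); rewrite mk /= => ->; case: odd; lia.
  + by exists (odd n).+1; move: om (odd_double_half n); rewrite mk /= => ->; case: odd; lia.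
- exists k; move: mk (odd_double_half n) => /=.
  by case: (odd n); case: (odd (alternating k)) => /=;
     [exists 1%N | exists 0%N | exists 2%N | exists 1%N]; lia.
Qed.

End SquareRootOfUnity.

End HankelRecursions.

(** * Integers with short runs in base two *)

(** One of the two valuations vanishes; for positive n the other is the length
    of the final run of equal binary digits. *)
Definition trailing_run n := (logn 2 n + logn 2 n.+1)%N.

Lemma logn2_odd n : odd n -> logn 2 n = 0%N.
Proof. by move=> odd_n; rewrite logn_coprime ?coprime2n. Qed.

Lemma logn2_double n : (0 < n)%N -> logn 2 n.*2 = (logn 2 n).+1.
Proof. by move=> n_gt0; rewrite -mul2n lognM // (pfactorK 1). Qed.

Lemma run_double n : (0 < n)%N -> trailing_run n.*2 = (logn 2 n).+1.
Proof.
move=> n_gt0; rewrite /trailing_run logn2_double // (logn2_odd n.*2.+1) ?addn0 //=.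
by rewrite odd_double.
Qed.

Lemma run_doubleS n : trailing_run n.*2.+1 = (logn 2 n.+1).+1.
Proof. by rewrite /trailing_run -doubleS logn2_double // (logn2_odd n.*2.+1) //= odd_double. Qed.

Section BoundedRuns.
Context {R : realFieldType} (T : pred nat) (d : nat) (b : R).
Hypotheses (T_double : forall n, (0 < n)%N -> T n.*2 -> T n)
           (T_doubleS : forall n, (0 < n)%N -> T n.*2.+1 -> T n)
           (T_run : forall n, (0 < n)%N -> T n -> (trailing_run n < d)%N).
Hypotheses (b_gt1 : 1 < b) (b_root : b ^+ d.-1 * (2 - b) <= 1).

(** The formula gives 0 for a run of length d, so it bounds the weight of a child
    also when the child has left T because its run became too long. *)
Definition run_weight n := if T n then b ^+ d - b ^+ trailing_run n else 0.

Let b_gt0 : 0 < b. Proof. exact: lt_trans b_gt1. Qed.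

(** One child prolongs the final run r of n and the other starts a run of length
    1, so the weights of the children add up to at most
    2 b^d - b - b^(r+1), and r drops out of the comparison with
    b (b^d - b^r). *)
Lemma run_weight_children n : (0 < n)%N ->
  run_weight n.*2 + run_weight n.*2.+1 <= b * run_weight n.
Proof.
move=> n_gt0; have [Tn|Tn] := boolP (T n); last first.
  rewrite /run_weight (negPf Tn) mulr0 (contraNF (T_double _ n_gt0)) //.
  by rewrite (contraNF (T_doubleS _ n_gt0)) // addr0.
have run_lt := T_run _ n_gt0 Tn.
have wle k m : (k <= d)%N -> trailing_run m = k -> run_weight m <= b ^+ d - b ^+ k.
  move=> ltkd runm; rewrite /run_weight runm; case: (T m) => //.
  by rewrite subr_ge0 ler_weXn2l // ltW.
have := lerD (wle (logn 2 n).+1 n.*2 _ (run_double _ n_gt0))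
             (wle (logn 2 n.+1).+1 n.*2.+1 _ (run_doubleS n)).
rewrite !(leq_ltn_trans _ run_lt) ?leq_addr ?leq_addl // => /(_ isT isT) /le_trans->//.
have -> : run_weight n = b ^+ d - b ^+ trailing_run n by rewrite /run_weight Tn.
have bd : b ^+ d = b * b ^+ d.-1 by rewrite -exprS prednK // (leq_ltn_trans _ run_lt).
(* One of the exponents is zero and the other is the trailing run. *)
have one_zero : b ^+ logn 2 n + b ^+ logn 2 n.+1 = 1 + b ^+ trailing_run n.
  rewrite /trailing_run; have [odd_n|even_n] := boolP (odd n).
    by rewrite (logn2_odd n) // expr0 add0n.
  by rewrite (logn2_odd n.+1) //= expr0 addn0 addrC.
rewrite -subr_ge0 !exprS.
have -> : b * (b ^+ d - b ^+ trailing_run n)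
    - (b ^+ d - b * b ^+ logn 2 n + (b ^+ d - b * b ^+ logn 2 n.+1))
  = b * (b ^+ logn 2 n + b ^+ logn 2 n.+1 - b ^+ trailing_run n) - (2 - b) * b ^+ d by ring.
rewrite one_zero addrK bd mulr1 [_ * (b * _)]mulrCA -[X in X - _]mulr1 -mulrBr.
by rewrite mulr_ge0 ?(ltW b_gt0) // subr_ge0 mulrC.
Qed.

Lemma sum_double_split (f : nat -> R) N : (0 < N)%N ->
  \sum_(1 <= n < N.*2) f n = f 1%N + \sum_(1 <= n < N) (f n.*2 + f n.*2.+1).
Proof.
elim: N => // -[_ _|N IHN _]; first by rewrite big_nat1 big_geq ?addr0.
rewrite doubleS big_nat_recr // big_nat_recr // IHN //.
by rewrite [in RHS]big_nat_recr //= !addrA.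
Qed.

Lemma sum_run_weight L :
  (b - 1) * \sum_(1 <= n < 2 ^ L) run_weight n <= b ^+ d * (b ^+ L - 1).
Proof.
elim: L => [|L IHL]; first by rewrite big_geq // subrr !mulr0.
rewrite expnS mul2n sum_double_split ?expn_gt0 //.
have w1 : run_weight 1 <= b ^+ d.
  rewrite /run_weight; case: (T 1); last by rewrite exprn_ge0 // ltW.
  by rewrite gerBl exprn_ge0 // ltW.
have step : \sum_(1 <= n < 2 ^ L) (run_weight n.*2 + run_weight n.*2.+1) <=
            b * \sum_(1 <= n < 2 ^ L) run_weight n.
  by rewrite big_distrr /= !big_nat; apply: ler_sum => n /andP[n_gt0 _];
    exact: run_weight_children.
have b1 : 0 <= b - 1 by rewrite subr_ge0 ltW.
have := ler_wpM2l b1 (lerD w1 step); move=> /le_trans; apply.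
rewrite exprS; have := ler_wpM2l (ltW b_gt0) IHL; lra.
Qed.

Lemma count_bounded_runs L :
  (count T (index_iota 1 (2 ^ L)))%:R <= b ^+ L * b / (b - 1) ^+ 2.
Proof.
have b1 : 0 < b - 1 by rewrite subr_gt0.
rewrite ler_pdivlMr ?exprn_gt0 //.
have [d0|d_gt0] := posnP d.
  rewrite (_ : count _ _ = 0%N) ?mul0r ?mulr_ge0 ?exprn_ge0 ?(ltW b_gt0) //.
  apply/eqP; rewrite -leqn0 leqNgt -has_count; apply/hasPn => n.
  rewrite mem_index_iota => /andP[n_gt0 _]; apply/negP => /(T_run _ n_gt0).
  by rewrite d0.
have bd : b ^+ d = b * b ^+ d.-1 by rewrite -exprS prednK.
have cw : (count T (index_iota 1 (2 ^ L)))%:R * (b ^+ d - b ^+ d.-1) <=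
          \sum_(1 <= n < 2 ^ L) run_weight n.
  rewrite -sum1_count natr_sum big_distrl big_mkcond /= !big_nat.
  apply: ler_sum => n /andP[n_gt0 _]; rewrite /run_weight; case: ifP => // Tn.
  rewrite mul1r lerB // ler_weXn2l ?(ltW b_gt1) //.
  by rewrite -ltnS prednK // T_run.
have bdp : 0 < b ^+ d.-1 by rewrite exprn_gt0.
have := le_trans (ler_wpM2l (ltW b1) cw) (sum_run_weight L).
rewrite bd [_ * (b ^+ L - 1)]mulrBr mulr1 => bound.
rewrite -(ler_pM2l bdp); have := mulr_gt0 b_gt0 bdp.
move: bound; set N := _%:R; rewrite expr2; lra.
Qed.

End BoundedRuns.

(** Take b = 2 - 2 / (q - 1) with q = 2^d.  Bounding (b / 2)^(d-1) by b / 2 gives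
    b^(d-1) (2 - b) <= q (q - 2) / (q - 1)^2 < 1. *)
Lemma run_base_exists (R : realFieldType) d : (1 < d)%N ->
  exists b : R, [/\ 1 < b, b < 2 * (1 - 2 ^- d) & b ^+ d.-1 * (2 - b) <= 1].
Proof.
move=> d_gt1; pose q : R := 2 ^+ d; pose r : R := (q - 2) / (q - 1).
have q_ge4 : 4 <= q.
  by rewrite (_ : 4 = 2 ^+ 2) ?ler_eXn2l ?ltr1n //; ring.
have q1_gt0 : 0 < q - 1 by lra.
exists (2 * r); split.
- rewrite /r mulrA ltr_pdivlMr //; lra.
- rewrite ltr_pM2l // -/q /r ltr_pdivrMr // mulrBl mul1r.
  have -> : q^-1 * (q - 1) = 1 - q^-1 by field; lra.
  by have : 0 < q^-1 by [rewrite invr_gt0; lra]; lra.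
- have -> : 2 - 2 * r = 2 / (q - 1) by rewrite /r; field; lra.
  have -> : (2 * r) ^+ d.-1 * (2 / (q - 1)) = q / (q - 1) * r ^+ d.-1.
    by rewrite exprMn /q -[in 2 ^+ d](prednK (ltnW d_gt1)) exprS; ring.
  have r_ge0 : 0 <= r by rewrite divr_ge0 //; lra.
  have r_le1 : r <= 1 by rewrite ler_pdivrMr //; lra.
  have d1_gt0 : (0 < d.-1)%N by rewrite -ltnS prednK // ltnW.
  have q_div_ge0 : 0 <= q / (q - 1) by rewrite divr_ge0 //; lra.
  apply: le_trans (ler_wpM2l q_div_ge0 (ler_iXnr d1_gt0 r_ge0 r_le1)) _.
  rewrite /r mulf_div ler_pdivrMr ?mulr_gt0 //; nra.
Qed.

(** * Digit polynomials at a point *)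

Lemma digit_polyE K n : (n < 2 ^ K)%N ->
  digit_poly n = \sum_(j < K) (odd (n %/ 2 ^ j))%:R *: 'X^j.
Proof.
have widen K1 K2 : (n < 2 ^ K1)%N -> (K1 <= K2)%N ->
    \sum_(j < K1) (odd (n %/ 2 ^ j))%:R *: 'X^j =
    \sum_(j < K2) (odd (n %/ 2 ^ j))%:R *: 'X^j :> {poly int}.
  move=> n_lt leK; rewrite (big_ord_widen _ (fun j => (odd (n %/ 2 ^ j))%:R *: 'X^j) leK).
  rewrite big_mkcond /=; apply: eq_bigr => j _; case: ltnP => // leKj.
  by rewrite divn_small ?scale0r // (leq_trans n_lt) // leq_pexp2l.
move=> n_lt; have n_ltL : (n < 2 ^ (trunc_log 2 n).+1)%N by exact: trunc_log_ltn.
pose M := maxn (trunc_log 2 n).+1 K.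
rewrite /digit_poly (widen _ M n_ltL) ?leq_maxl //.
by rewrite [RHS](widen _ M n_lt) ?leq_maxr.
Qed.

Lemma digit_poly_bit (b : bool) n : digit_poly (b + n.*2) = 'X * digit_poly n + b%:R%:P.
Proof.
have n_lt : (n < 2 ^ n)%N by exact: ltn_expl.
have bn_lt : (b + n.*2 < 2 ^ n.+1)%N by rewrite expnS mul2n; case: b; lia.
rewrite (digit_polyE _ _ n_lt) (digit_polyE _ _ bn_lt).
rewrite big_ord_recl /= expn0 divn1 oddD odd_double addbF oddb expr0 addrC.
congr (_ + _); last by rewrite -[RHS]mulr1 mul_polyC.
rewrite big_distrr; apply: eq_bigr => j _ /=.
rewrite -scalerAr -exprS; congr (_%:R *: _); congr (nat_of_bool (odd _)).
by rewrite expnS divnMA divn2 half_bit_double.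
Qed.

Definition digit_eval (F : comNzRingType) (t : F) n :=
  (map_poly intr (digit_poly n)).[t].
Arguments digit_eval {F}.

Section DigitEval.
Context {F : fieldType} (t : F).

Lemma digit_eval_double n : digit_eval t n.*2 = t * digit_eval t n.
Proof.
rewrite /digit_eval -[n.*2]add0n (digit_poly_bit false) addr0.
by rewrite rmorphM /= map_polyX mulrC hornerMX mulrC.
Qed.

Lemma digit_eval_doubleS n : digit_eval t n.*2.+1 = t * digit_eval t n + 1.
Proof.
rewrite /digit_eval -[n.*2.+1]add1n (digit_poly_bit true) rmorphD rmorphM /=.
by rewrite map_polyX mulrC hornerD hornerMX mulrC map_polyC /= hornerC.
Qed.

Lemma hankel_eval n : (map_poly intr (hankel n)).[t] = hank (digit_eval t) n.
Proof.
rewrite -[LHS]/(horner_eval t (map_poly intr (hankel n))) /hankel -!det_map_mx.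
by congr (\det _); apply/matrixP => i j; rewrite !mxE.
Qed.

End DigitEval.

(** * Counting *)

Lemma count_upto_size (R : realType) (P : pred nat) (x : R) (s : seq nat) :
  (forall n, (0 < n)%N -> n%:R <= x -> P n -> n \in s) ->
  (count_upto P x <= size s)%N.
Proof.
move=> Ps; rewrite /count_upto cardE -(size_map val); apply: uniq_leq_size.
  by rewrite map_inj_uniq ?enum_uniq //; exact: val_inj.
by move=> _ /mapP[n + ->]; rewrite mem_enum inE => /and3P[n_gt0 nx Pn]; exact: Ps.
Qed.

Definition binlog (R : realType) (x : R) := trunc_log 2 (Num.truncn x).

Lemma expn_binlog_le (R : realType) (x : R) : 1 <= x -> 2 ^+ binlog R x <= x.
Proof.
move=> x_ge1; rewrite -natrX -truncn_ge_nat ?(le_trans ler01) //.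
by rewrite trunc_logP // truncn_gt0.
Qed.

Lemma lt_expn_binlog (R : realType) (x : R) n : n%:R <= x -> (n < 2 ^ (binlog R x).+1)%N.
Proof.
move=> nx; apply: leq_ltn_trans (trunc_log_ltn _ _) => //.
by rewrite truncn_ge_nat // (le_trans _ nx).
Qed.

Lemma binlog_le_log2 (R : realType) (x : R) : 1 <= x -> (binlog R x)%:R <= log2 x.
Proof.
move=> x_ge1; have ln2_gt0 : 0 < ln (2 : R) by rewrite ln_gt0 // ltr1n.
rewrite /log2 ler_pdivlMr // mulr_natl -lnXn // ler_ln ?expn_binlog_le ?posrE ?exprn_gt0 //.
exact: lt_le_trans x_ge1.
Qed.

Lemma alternating_ge k : (2 ^ k <= alternating k.+1)%N.
Proof.
elim: k => // k; rewrite expnS mul2n.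
by have -> : alternating k.+2 = ((alternating k.+1).*2 + ~~ odd (alternating k.+1))%N; [| lia].
Qed.

(** The evaluation is moved from the integers to the rationals, where the ratio
    2 / t = -1 has square one. *)
Lemma hankel_alt n : (0 < n)%N -> (hankel n).[-2] != 0 ->
  exists k r, [/\ (0 < k)%N, (r < 3)%N & n = (alternating k.+1 + r)%N].
Proof.
move=> n_gt0 hn.
have t_neq0 : (-2 : rat) != 0 by [].
have hn' : hank (digit_eval (-2 : rat)) n != 0.
  have -> : -2 = ((-2)%:~R : rat) by rewrite rmorphN.
  by rewrite -hankel_eval horner_map /= intr_eq0.
apply: (hank_alt (-2) (digit_eval (-2)) t_neq0 _
          (digit_eval_double _) (digit_eval_doubleS _)) => //.
rewrite ltn_neqAle eq_sym n_gt0 andbT; apply: contra_neq hn' => ->.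
rewrite /hank ndet1 addn0; have := digit_eval_double (-2 : rat) 0; rewrite double0; lra.
Qed.

Lemma count_minus_two (R : realType) (x : R) : 1 <= x ->
  (count_upto (fun n => (hankel n).[-2] != 0) x)%:R <= 3 * log2 x.
Proof.
move=> x_ge1; pose L := binlog R x.
pose s := [seq (alternating k.+1 + r)%N | k <- iota 1 L, r <- iota 0 3].
have size_s : size s = (L * 3)%N by rewrite size_allpairs !size_iota.
have : (count_upto (fun n => (hankel n).[-2] != 0) x <= L * 3)%N.
  rewrite -size_s; apply: count_upto_size => n n_gt0 nx /hankel_alt -/(_ n_gt0).
  case=> k [r [k_gt0 r_lt3 n_eq]]; rewrite n_eq.
  apply: allpairs_f; rewrite mem_iota ?add0n ?r_lt3 //.
  rewrite k_gt0 add1n -(ltn_exp2l _ _ (isT : 1 < 2)%N).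
  apply: leq_ltn_trans (lt_expn_binlog _ _ _ nx).
  by rewrite n_eq (leq_trans (alternating_ge k)) // leq_addr.
rewrite -(ler_nat R) => /le_trans; apply; rewrite natrM mulrC ler_wpM2l //.
exact: binlog_le_log2.
Qed.

(** Apart from 1, an index n with nonzero determinant is b + 2 m with b < 2 and m
    regular, m = 2^k (2 g + 1) with k < d and g zero or a twin, which gives at
    most 2 d choices of (b, k) for each g. *)
Lemma count_root_of_unity (R : realType) (F : fieldType) (t : F) d :
  t != 0 -> 2 != 0 :> F -> (0 < d)%N -> (2 / t) ^+ d = 1 ->
  exists T : pred nat,
    [/\ forall n, (0 < n)%N -> T n.*2 -> T n, forall n, (0 < n)%N -> T n.*2.+1 -> T n,
        forall n, (0 < n)%N -> T n -> (trailing_run n < d)%N &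
        forall x : R, 1 <= x ->
          (count_upto (fun n => ((map_poly intr (hankel n)).[t] != 0)%R) x <=
           1 + 2 * (d * (1 + count T (index_iota 1 (2 ^ (binlog R x).+1)))))%N].
Proof.
move=> t_neq0 two_neq0 d_gt0 wd1.
pose S := digit_eval t.
have S2 : forall n, S n.*2 = t * S n by exact: digit_eval_double.
have S2S : forall n, S n.*2.+1 = t * S n + 1 by exact: digit_eval_doubleS.
exists (twin S); split.
- exact: (twin_double t S t_neq0 two_neq0 S2 S2S).
- exact: (twin_doubleS t S t_neq0 two_neq0 S2 S2S).
- move=> n n_gt0 /andP[reg_n reg_n1].
  have log_lt m : (0 < m)%N -> regular S m -> (logn 2 m < d)%N.
    case/pow2_oddP => k [g ->] reg.
    have := regular_pow2_odd t S t_neq0 two_neq0 S2 S2S d d_gt0 wd1 k g reg.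
    by rewrite lognM ?expn_gt0 // pfactorK // (logn2_odd g.*2.+1) ?addn0 //= odd_double.
  rewrite /trailing_run; case: (boolP (odd n)) => [odd_n|even_n].
    by rewrite (logn2_odd n) // log_lt.
  by rewrite (logn2_odd n.+1) //= addn0 log_lt.
move=> x x_ge1; set L := binlog R x.
pose gs := 0%N :: [seq g <- index_iota 1 (2 ^ L.+1) | twin S g].
pose ms := [seq (2 ^ k * g.*2.+1)%N | k <- iota 0 d, g <- gs].
pose s := 1%N :: [seq (b + m.*2)%N | b <- iota 0 2, m <- ms].
have -> : (1 + 2 * (d * (1 + count (twin S) (index_iota 1 (2 ^ L.+1)))) = size s)%N.
  have -> : size s = (2 * (d * size gs)).+1.
    by rewrite -[LHS]/(size (allpairs _ _ _)).+1 !size_allpairs !size_iota.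
  by rewrite -[size gs]/(size (seq.filter _ _)).+1 size_filter !add1n.
apply: count_upto_size => n n_gt0 nx; rewrite hankel_eval => hn; rewrite inE.
have [n1|n_gt1] := leqP n 1; first by rewrite eqn_leq n1 n_gt0.
apply/orP; right; have m_gt0 : (0 < n./2)%N by rewrite half_gt0.
have reg := hank_regular t S t_neq0 two_neq0 S2 S2S n n_gt1 hn.
rewrite -(odd_double_half n); apply: allpairs_f; first by rewrite mem_iota; case: odd.
have [k [g n_eq]] := pow2_oddP _ m_gt0; rewrite n_eq in reg *; apply: allpairs_f.
  by rewrite mem_iota add0n (regular_pow2_odd t S t_neq0 two_neq0 S2 S2S d d_gt0 wd1 k g).
rewrite inE mem_filter mem_index_iota.
have [//|g_gt0] := posnP g; apply/orP; right.
have reg_g : regular S g.*2.+1.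
  elim: k reg {n_eq} => [|k IHk]; first by rewrite mul1n.
  rewrite expnS -mulnA mul2n => reg; apply: IHk.
  by apply: (regular_double t S t_neq0 two_neq0 S2 S2S) reg; rewrite muln_gt0 expn_gt0.
rewrite /twin (regular_doubleS t S t_neq0 two_neq0 S2 S2S g g_gt0 reg_g) /=.
apply: leq_ltn_trans (lt_expn_binlog _ _ _ nx).
have le_half : (n./2 <= n)%N by rewrite -{2}(odd_double_half n) -addnn addnA leq_addl.
rewrite (leq_trans _ le_half) // n_eq (leq_trans _ (leq_pmull _ _)) ?expn_gt0 //.
by rewrite -addnn -addnS leq_addr.
Qed.

Lemma powR_log2 (R : realType) (b : R) : 0 < b -> 2 `^ log2 b = b.
Proof.
move=> b_gt0; have ln2_gt0 : 0 < ln (2 : R) by rewrite ln_gt0 // ltr1n.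
rewrite /powR pnatr_eq0 /= /log2 divfK ?gt_eqF //; exact: lnK.
Qed.

Theorem theorem5p5 (R : realType) :
  (forall x : R, 1 <= x ->
     (count_upto (fun n => (hankel n).[-2] != 0) x)%:R <= 3 * log2 x) /\
  (forall d : nat, (3 <= d)%N ->
     exists delta : R,
       [/\ delta < 1 + log2 (1 - 2 ^- d),
           1 + log2 (1 - 2 ^- d) < 1 :> R &
           forall zeta : R[i], zeta ^+ d = 1 ->
             (fun x : R => (count_upto (fun n =>
                (map_poly intr (hankel n)).[2 * zeta] != 0) x)%:R : R^o)
             =O_ +oo (fun x : R => x `^ delta : R^o)]).
Proof.
split=> [x|d d_ge3]; first exact: count_minus_two.
have d_gt0 : (0 < d)%N by exact: leq_trans d_ge3.
have [b [b_gt1 b_lt b_root]] := run_base_exists R d (ltnW d_ge3).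
have b_gt0 : 0 < b by exact: lt_trans b_gt1.
have ln2_gt0 : 0 < ln (2 : R) by rewrite ln_gt0 // ltr1n.
have q_gt0 : 0 < 1 - 2 ^- d :> R by rewrite -(pmulr_rgt0 _ (ltr0Sn R 1)) (lt_trans b_gt0).
have q_lt1 : 1 - 2 ^- d < 1 :> R by rewrite gtrBl invr_gt0 exprn_gt0.
exists (log2 b); split.
- have -> : 1 + log2 (1 - 2 ^- d) = log2 (2 * (1 - 2 ^- d)) :> R.
    by rewrite /log2 lnM ?posrE // mulrDl divff ?gt_eqF.
  by rewrite ltr_pM2r ?invr_gt0 // ltr_ln ?posrE ?mulr_gt0.
- by rewrite gtrDl /log2 pmulr_llt0 ?invr_gt0 // ln_lt0 // q_gt0.
move=> zeta zetad.
have zeta_neq0 : zeta != 0.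
  by apply: contra_eq_neq zetad => ->; rewrite expr0n gtn_eqF // eq_sym oner_neq0.
have t_neq0 : 2 * zeta != 0 by rewrite mulf_neq0 // pnatr_eq0.
have wd1 : (2 / (2 * zeta)) ^+ d = 1.
  by rewrite invfM mulrA divff ?pnatr_eq0 // mul1r exprVn zetad invr1.
have [|T [T2 T2S Trun count_le]] := count_root_of_unity R _ _ d t_neq0 _ d_gt0 wd1.
  by rewrite pnatr_eq0.
pose C : R := b * b / (b - 1) ^+ 2.
(* C b^L bounds the number of twins below 2^(L+1). *)
have C_ge0 : 0 <= C.
  by rewrite divr_ge0 ?exprn_ge0 ?mulr_ge0 ?subr_ge0 ?(ltW b_gt0) ?(ltW b_gt1).
have K_ge1 : 1 <= 1 + 2 * d%:R * (1 + C).
  by rewrite lerDl; apply: mulr_ge0; [apply: mulr_ge0 | apply: addr_ge0].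
apply/eqO_exP; exists (1 + 2 * d%:R * (1 + C)); first exact: lt_le_trans K_ge1.
near=> x.
have x_ge1 : 1 <= x by near: x; apply: nbhs_pinfty_ge; rewrite num_real.
have delta_ge0 : 0 <= log2 b.
  by rewrite /log2 divr_ge0 ?(ltW ln2_gt0) // ln_ge0 // ltW.
set L := binlog R x.
have bL : b ^+ L <= x `^ log2 b.
  have pow_nneg : (2 : R) ^+ L \in Num.nneg by rewrite nnegrE exprn_ge0.
  have x_nneg : x \in Num.nneg by rewrite nnegrE (le_trans ler01).
  apply: le_trans (ge0_ler_powR delta_ge0 pow_nneg x_nneg (expn_binlog_le R x x_ge1)).
  by rewrite -powR_mulrn // powRAC powR_log2 // powR_mulrn // ltW.
rewrite /= ger0_norm // ger0_norm ?powR_ge0 //.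
have K_ge0 := le_trans ler01 K_ge1.
apply: le_trans (ler_wpM2l K_ge0 bL).
have := count_le x x_ge1; rewrite -(ler_nat R) => /le_trans; apply.
rewrite !(natrD, natrM).
have bL_ge1 : 1 <= b ^+ L by rewrite exprn_ege1 // ltW.
have := count_bounded_runs T d b T2 T2S Trun b_gt1 b_root L.+1.
rewrite (_ : b ^+ L.+1 * b / (b - 1) ^+ 2 = C * b ^+ L); last by rewrite exprS /C; ring.
move: (count _ _)%:R => N N_le.
have d_ge0 : 0 <= d%:R :> R by [].
have := mulr_ge0 d_ge0 (ltW (lt_le_trans ltr01 bL_ge1)).
have := ler_wpM2l d_ge0 N_le; have := ler_wpM2l d_ge0 bL_ge1; lra.
Unshelve. all: by end_near.
Qed.
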